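(* $(-2,2)\cup\mathrm{i}(-2,2)\subset\operatorname{int}(\Sigma_\pi)$.
   Context: For $c\in\{\pm1\}^{\mathbb{Z}}$ let $A_c$ be the bounded operator on $\ell^2(\mathbb{Z})$ given by $(A_c\phi)_m=c_m\phi_{m-1}+\phi_{m+1}$, $m\in\mathbb{Z}$. $\pi_\infty$ is the union of the spectra (on $\ell^2(\mathbb{Z})$) of $A_c$ over all periodic $c\in\{\pm1\}^{\mathbb{Z}}$, and $\Sigma_\pi:=\overline{\pi_\infty}\subset\mathbb{C}$. $\operatorname{int}$ denotes interior in $\mathbb{C}$; $(-2,2)$ is the real open interval viewed as a subset of $\mathbb{C}$. *)

(* Defs.v *)
From HB Require Import structures.
From mathcomp Require Import all_boot all_order all_algebra.
From mathcomp Require Import complex.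
From mathcomp Require Import all_classical all_reals all_analysis.
From mathcomp Require Import ring lra.
Import Order.TTheory GRing.Theory Num.Theory numFieldNormedType.Exports.

Set Implicit Arguments.
Unset Strict Implicit.
Unset Printing Implicit Defensive.

Local Open Scope classical_set_scope.
Local Open Scope ring_scope.
Local Open Scope complex_scope.

(* [R[i]] itself is not a declared instance of [topologicalType]; the ascription
   to [numFieldType] is what gives it the topology of its norm. *)
Notation Cplx R := (R[i] : numFieldType).

Section L2Z.
Variable R : realType.
Local Notation C := (Cplx R).
Implicit Types (phi psi : int -> C) (T B : (int -> C) -> int -> C).

Definition sqsum phi : \bar R :=
  \esum_(m in [set: int]) ((Normc.normc (phi m)) ^+ 2)%:E.

Definition l2 : set (int -> C) := [set phi | (sqsum phi < +oo)%E].

Definition l2norm phi : R := Num.sqrt (fine (sqsum phi)).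

(* A bounded operator on l2 is represented by a map on all sequences; its values
   outside l2 are irrelevant. *)
Definition bounded_operator T : Prop :=
  [/\ forall phi, l2 phi -> l2 (T phi),
      forall (a : C) phi psi, l2 phi -> l2 psi ->
        T (fun m => a * phi m + psi m) = (fun m => a * T phi m + T psi m)
    & exists M : R, forall phi, l2 phi -> l2norm (T phi) <= M * l2norm phi].

Definition sub_scalar T (lambda : C) : (int -> C) -> int -> C :=
  fun phi m => T phi m - lambda * phi m.

Definition inverse_on_l2 T B : Prop :=
  forall phi, l2 phi -> B (T phi) = phi /\ T (B phi) = phi.

Definition spectrum T : set C :=
  [set lambda | ~ exists B,
     bounded_operator B /\ inverse_on_l2 (sub_scalar T lambda) B].

End L2Z.

Section HoppingOperator.
Variable R : realType.
Local Notation C := (Cplx R).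

Definition pm1_seq : set (int -> C) :=
  [set c | forall m, c m = 1 \/ c m = -1].

Definition periodic_seq : set (int -> C) :=
  [set c | exists n : nat, (0 < n)%N /\ forall m : int, c (m + n%:Z) = c m].

Definition hopping (c : int -> C) (phi : int -> C) : int -> C :=
  fun m => c m * phi (m - 1) + phi (m + 1).

Definition pi_infty : set C :=
  \bigcup_(c in pm1_seq `&` periodic_seq) spectrum (hopping c).

Definition Sigma_pi : set C := closure pi_infty.

Definition real_segment : set C := [set x%:C | x in `](-2 : R), 2[].

Definition imag_segment : set C := [set 'i * x%:C | x in `](-2 : R), 2[].

Let sqsum_shift (phi : int -> C) (k : int) :
  sqsum (fun m => phi (m + k)) = sqsum phi.
Proof.
rewrite /sqsum; symmetry.
apply: (reindex_esum setT setT (fun m : int => m + k)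
  (fun m => ((Normc.normc (phi m)) ^+ 2)%:E)).
split=> //; first by move=> x y _ _ /addIr.
by move=> y _; exists (y - k) => //; rewrite subrK.
Qed.

Let sqsum_ge0 (phi : int -> C) : (0 <= sqsum phi)%E.
Proof. by apply: esum_ge0 => m _; rewrite lee_fin sqr_ge0. Qed.

Let normc_ge0 (z : C) : 0 <= Normc.normc z.
Proof. by case: z => a b; rewrite /Normc.normc sqrtr_ge0. Qed.

Let sqsum_hopping (c phi : int -> C) : pm1_seq c ->
  (sqsum (hopping c phi) <= 4%:E * sqsum phi)%E.
Proof.
move=> hc.
pose f (k m : int) : \bar R := ((Normc.normc (phi (m + k))) ^+ 2)%:E.
have f0 k m : [set: int] m -> (0 <= f k m)%E.
  by move=> _; rewrite lee_fin sqr_ge0.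
have fE k : \esum_(m in [set: int]) f k m = sqsum phi by apply: sqsum_shift.
have -> : (4%:E * sqsum phi =
    \esum_(m in [set: int]) ((f (-1)%R m + f (-1)%R m) + (f 1%R m + f 1%R m)))%E.
  rewrite !esumD //; try by move=> m _; rewrite ?adde_ge0 ?f0.
  rewrite !fE; have := sqsum_ge0 phi.
  case: (sqsum phi) => [r|_|] //; last by rewrite gt0_muley ?lte_fin.
  by move=> _; rewrite -EFinM -!EFinD; congr EFin; ring.
apply: le_esum => m _; rewrite -!EFinD lee_fin /hopping.
have := le_normcD (c m * phi (m - 1)) (phi (m + 1)).
have -> : Normc.normc (c m * phi (m - 1)) = Normc.normc (phi (m - 1)).
  by case: (hc m) => ->; rewrite ?mul1r // mulN1r normcN.
have := normc_ge0 (c m * phi (m - 1) + phi (m + 1)).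
set u := Normc.normc (phi _); set v := Normc.normc (phi (m + 1)).
set w := Normc.normc _ => w0 wuv.
have : w ^+ 2 <= (u + v) ^+ 2 by rewrite lerXn2r ?nnegrE ?(le_trans w0).
have := sqr_ge0 (u - v); lra.
Qed.

Lemma bounded_operator_hopping (c : int -> C) :
  pm1_seq c -> bounded_operator (hopping c).
Proof.
move=> hc; split.
- move=> phi hphi; apply: (le_lt_trans (sqsum_hopping phi hc)).
  by rewrite lte_mul_pinfty ?lee_fin.
- by move=> a phi psi _ _; apply/funext => m; rewrite /hopping; ring.
- exists 2 => phi hphi.
  have F : sqsum phi \is a fin_num by rewrite ge0_fin_numE.
  have -> : (2 : R) = Num.sqrt 4.
    by rewrite (_ : 4 = 2 ^+ 2 :> R) ?sqrtr_sqr ?normr_nat //; ring.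
  rewrite /l2norm -sqrtrM // ler_sqrt; last first.
    by rewrite mulr_ge0 ?fine_ge0.
  rewrite -[4]/(fine 4%:E) -fineM // fine_le ?sqsum_hopping ?fin_numM //.
  rewrite ge0_fin_numE //; apply: (le_lt_trans (sqsum_hopping phi hc)).
  by rewrite lte_mul_pinfty ?lee_fin.
Qed.

End HoppingOperator.

Arguments pi_infty : clear implicits.
Arguments Sigma_pi : clear implicits.
Arguments real_segment : clear implicits.
Arguments imag_segment : clear implicits.

(* Main.v *)
(* If [A_c] has a nonzero bounded solution of [A_c phi = lam phi], then [lam] is
   in its spectrum. Write [U_(n-1)] for the Chebyshev polynomial of the second
   kind and [P_n(x) = x U_(n-1)(x/2)]. Up to the value 0, the eigenvalues [lam]
   of such bounded solutions with periodic [c] are closed under taking preimages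
   by every [P_n], [n >= 2], and they contain [-2, 2] (take c = 1). As [P_2] is
   squaring, they contain all [2^k]-th roots of the numbers in (0, 1], hence a
   dense subset of the unit disc, so the closure contains every open set
   [|P_n| < 1]. For x = 2 cos t in (-2, 2) we have
   [P_n(x) = x sin (n t) / sin t], which is small for suitable n by recurrence.
   The imaginary segment follows by the gauge transformation
   [phi_m |-> i^m phi_m], [c |-> -c]. *)
Require Import Defs.
From HB Require Import structures.
From mathcomp Require Import all_boot all_order all_algebra.
From mathcomp Require Import complex.
From mathcomp Require Import all_classical all_reals all_analysis.
From mathcomp Require Import ring lra zify.
Import Order.TTheory GRing.Theory Num.Theory.
Import numFieldNormedType.Exports.

Set Implicit Arguments.
Unset Strict Implicit.
Unset Printing Implicit Defensive.

Local Open Scope classical_set_scope.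
Local Open Scope ring_scope.

(** * Chebyshev polynomials and their invariants *)

(* [cheb x n] is [U_(n-1)(x/2)]. *)
Fixpoint cheb (K : comNzRingType) (x : K) (n : nat) : K :=
  match n with
  | 0 => 0
  | m.+1 => if m is k.+1 then x * cheb x m - cheb x k else 1
  end.

Lemma chebS (K : comNzRingType) (x : K) n :
  cheb x n.+2 = x * cheb x n.+1 - cheb x n.
Proof. by []. Qed.

Lemma rmorph_cheb (K L : comNzRingType) (f : {rmorphism K -> L}) x n :
  f (cheb x n) = cheb (f x) n.
Proof.
suff [] : f (cheb x n) = cheb (f x) n /\ f (cheb x n.+1) = cheb (f x) n.+1 by [].
elim: n => [|n [IH1 IH2]]; first by rewrite /= rmorph0 rmorph1.
by split=> //; rewrite !chebS rmorphB rmorphM IH1 IH2.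
Qed.

Lemma horner_cheb (K : comNzRingType) (x : K) n : (cheb 'X n).[x] = cheb x n.
Proof. by rewrite -[LHS]/(horner_eval x _) rmorph_cheb /= /horner_eval hornerX. Qed.

(** The left side is the Casoratian of the solutions [cheb x k] and [cheb x (k + m)] of one
    recurrence, so it does not depend on [n]; the case [n = 0] gives its value. *)
Lemma cheb_wronskian (K : comNzRingType) (x : K) n m :
  cheb x n.+1 * cheb x (n + m) - cheb x n * cheb x (n + m).+1 = cheb x m.
Proof.
elim: n => [|n IH]; first by rewrite /= mul1r mul0r subr0.
by rewrite -[RHS]IH !addSn !chebS; ring.
Qed.

(** The form [a^2 + b^2 - x a b] is invariant under the recurrence step [(a, b) -> (b, x b - a)] and
    equals 1 at [(0, 1)]. For real [|x| < 2] it is positive definite, which bounds the whole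
    sequence. *)
Lemma cheb_energy (K : comNzRingType) (x : K) n :
  cheb x n ^+ 2 + cheb x n.+1 ^+ 2 - x * cheb x n * cheb x n.+1 = 1.
Proof.
elim: n => [|n IH]; first by rewrite /=; ring.
by rewrite -[RHS]IH chebS; ring.
Qed.

Lemma size_cheb (K : idomainType) n : size (cheb ('X : {poly K}) n) = n.
Proof.
suff [] : size (cheb ('X : {poly K}) n) = n /\
  size (cheb ('X : {poly K}) n.+1) = n.+1 by [].
elim: n => [|n [IH1 IH2]]; first by rewrite /= size_poly0 size_poly1.
split=> //; rewrite chebS mulrC.
have sX : size (cheb ('X : {poly K}) n.+1 * 'X) = n.+2.
  by rewrite size_mulX ?IH2 // -size_poly_eq0 IH2.
by rewrite size_polyDl ?sX // size_polyN IH1 ltnW.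
Qed.

Lemma monic_cheb (K : idomainType) n : cheb ('X : {poly K}) n.+1 \is monic.
Proof.
elim: n => [|n IH]; first by rewrite monic1.
rewrite chebS mulrC monicE lead_coefDl.
  by rewrite lead_coefMX -monicE.
have c0 : cheb ('X : {poly K}) n.+1 != 0 by rewrite -size_poly_eq0 size_cheb.
by rewrite size_polyN size_mulX // !size_cheb.
Qed.

(** * Approximation by complex roots *)

(** A monic polynomial is the product of its factors [z - y]; if each had modulus at least [e], the
    value at [z] would have modulus at least [e] to the degree. *)
Lemma root_close (C : numClosedFieldType) (p : {poly C}) (z e : C) :
  p \is monic -> 0 < e -> `|p.[z]| < e ^+ (size p).-1 ->
  exists2 y, root p y & `|z - y| < e.
Proof.
move=> /monicP p1 e0; have [r] := closed_field_poly_normal p.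
rewrite p1 scale1r => ->; rewrite size_prod_XsubC horner_prod /= => h.
apply: contrapT => far; move: h; apply/negP.
rewrite -real_leNgt ?realX ?(gtr0_real e0) ?normr_real // normr_prod.
have {}far y : y \in r -> e <= `|(('X - y%:P).[z])|.
  move=> yr; rewrite real_leNgt ?(gtr0_real e0) ?normr_real // hornerXsubC.
  by apply/negP => zy; apply: far; exists y; rewrite ?root_prod_XsubC.
elim: r far => [|y r IH] far; first by rewrite big_nil expr0.
rewrite big_cons exprS ler_pM ?exprn_ge0 ?(ltW e0) //.
- by apply: far; rewrite mem_head.
- by apply: IH => t tr; apply: far; rewrite inE tr orbT.
Qed.

(* Take square roots repeatedly: by the parallelogram law one of the two square
   roots of an approximation of [z ^+ 2] is a better approximation of [z]. *)
Lemma dyadic_root_close (C : numClosedFieldType) (k : nat) (z : C) :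
  exists w : C, [/\ `|w| = `|z|, w ^+ (2 ^ k) = `|z| ^+ (2 ^ k)
    & 2 ^+ k * `|z - w| ^+ 2 <= 4 * `|z| ^+ 2].
Proof.
elim: k z => [|k IH] z.
  exists `|z|; rewrite normr_id expr0 mul1r; split => //.
  rewrite (_ : 4 = 2 ^+ 2); last by ring.
  rewrite -exprMn lerXn2r ?nnegrE ?mulr_ge0 //.
  by rewrite (le_trans (ler_normB _ _)) // normr_id; rewrite mulr_natl mulr2n.
have [->|z0] := eqVneq z 0.
  by exists 0; rewrite subrr normr0; split=> //; rewrite expr0n !mulr0.
have [w2 [w2n w2k w2d]] := IH (z ^+ 2).
have [w wE] : exists w, w ^+ 2 = w2 by exists (sqrtC w2); rewrite sqrtCK.
have nw : `|w| = `|z|.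
  by apply/eqP; rewrite -(@eqrXn2 _ 2) // -!normrX wE w2n.
have par : `|z - w| ^+ 2 + `|z + w| ^+ 2 = 4 * `|z| ^+ 2.
  have nwC : w * w^* = z * z^* by rewrite -!normCK nw.
  rewrite !normCK rmorphB rmorphD /=.
  rewrite (_ : _ + _ = 2 * (z * z^*) + 2 * (w * w^*)); last by ring.
  by rewrite nwC; ring.
have prd : `|z - w| * `|z + w| = `|z ^+ 2 - w2|.
  by rewrite -normrM -wE; congr `|_|; ring.
have wk s : s ^+ 2 = 1 -> (s * w) ^+ (2 ^ k.+1) = `|z| ^+ (2 ^ k.+1).
  move=> s2; rewrite expnS !exprM [(s * w) ^+ 2]exprMn s2 mul1r wE w2k.
  by rewrite normrX.
(* The smaller distance [a] gains a factor 2: the larger one satisfies [b^2 >= 2 |z|^2], while [a b]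
   is the error already controlled for [z ^+ 2]. *)
have main (a b : C) : 0 <= a -> 0 <= b -> a ^+ 2 + b ^+ 2 = 4 * `|z| ^+ 2 ->
    a * b = `|z ^+ 2 - w2| -> a <= b -> 2 ^+ k.+1 * a ^+ 2 <= 4 * `|z| ^+ 2.
  move=> a0 b0 ab abz leab.
  have b2 : 2 * `|z| ^+ 2 <= b ^+ 2.
    have : a ^+ 2 <= b ^+ 2 by rewrite lerXn2r.
    rewrite -(lerD2r (b ^+ 2)) ab (_ : 4 * _ = 2 * (2 * `|z| ^+ 2)); last by ring.
    by rewrite (_ : _ + _ = 2 * b ^+ 2) ?ler_pM2l //; ring.
  have n0 : 0 < `|z| ^+ 2 by rewrite exprn_gt0 ?normr_gt0.
  rewrite -(ler_pM2r n0).
  have : 2 ^+ k * (a * b) ^+ 2 <= 4 * (`|z| ^+ 2) ^+ 2.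
    by move: w2d; rewrite abz [in X in X -> _]normrX.
  have : 2 ^+ k * a ^+ 2 * (2 * `|z| ^+ 2) <= 2 ^+ k * a ^+ 2 * b ^+ 2.
    by rewrite ler_wpM2l // mulr_ge0 ?exprn_ge0.
  move=> h1 h2; rewrite -(mulrA 4) -expr2; apply: (le_trans _ h2).
  rewrite exprMn (mulrA (2 ^+ k)); apply: (le_trans _ h1).
  by rewrite exprS le_eqVlt; apply/orP; left; apply/eqP; ring.
have [h|h] : `|z - w| <= `|z + w| \/ `|z + w| <= `|z - w|.
- by apply/orP; apply: real_leVge; rewrite normr_real.
- exists w; split=> //; first by have := wk 1; rewrite expr1n mul1r; apply.
  exact: (main _ _ _ _ par prd h).
- exists (- w); rewrite normrN opprK; split=> //.
    by have := wk (-1); rewrite sqrrN expr1n mulN1r; apply.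
  by apply: (main _ _ _ _ _ _ h) => //; [rewrite addrC|rewrite mulrC].
Qed.

(** * Recurrence and small Chebyshev values *)

Lemma pigeonhole (T : finType) (f : nat -> T) :
  exists a b, (a < b)%N /\ f a = f b.
Proof.
have /injectivePn [i [j ij e]] : ~~ injectiveb (fun i : 'I_(#|T|.+1) => f i).
  apply/negP => /injectiveP /leq_card; rewrite card_ord; lia.
case: (ltngtP i j) => [h|h|/val_inj h]; last by rewrite h eqxx in ij.
- by exists i, j.
- by exists j, i.
Qed.

(** Cutting [[-B, B]] into cells of width [e] leaves finitely many pairs of cells, so two indices
    share a pair. *)
Lemma bounded_pair_recurrence (R : realType) (f g : nat -> R) (B e : R) :
  0 < e -> (forall n, `|f n| <= B) -> (forall n, `|g n| <= B) ->
  exists a b, [/\ (a < b)%N, `|f a - f b| < e & `|g a - g b| < e].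
Proof.
move=> e0 hf hg.
have cell (h : nat -> R) : (forall n : nat, `|h n| <= B) ->
    exists (N : nat) (F : nat -> 'I_N),
    forall a b, F a = F b -> `|h a - h b| < e.
  move=> hh; pose t n := Num.trunc ((h n + B) / e).
  have B0 n : 0 <= (h n + B) / e.
    by rewrite divr_ge0 ?(ltW e0) //; have := hh n; rewrite ler_norml; lra.
  have tP n : (t n)%:R <= (h n + B) / e < (t n).+1%:R by apply: truncn_itv.
  have tN n : (t n < (Num.trunc ((B + B) / e)).+1)%N.
    rewrite ltnS; apply: le_truncn; rewrite ler_pM2r ?invr_gt0 //.
    by have := hh n; rewrite ler_norml; lra.
  exists _, (fun n => Ordinal (tN n)) => a b [] tab.
  have := tP a; have := tP b; rewrite tab -natr1.
  rewrite !ler_pdivlMr // !ltr_pdivrMr //.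
  by set T := _%:R; move=> /andP[? ?] /andP[? ?]; rewrite ltr_norml; lra.
have [N [F FP]] := cell f hf; have [M [G GP]] := cell g hg.
have [a [b [ab [/FP h1 /GP h2]]]] := pigeonhole (fun n => (F n, G n)).
by exists a, b.
Qed.

(** Consecutive values form a bounded orbit in the plane, which nearly returns to itself at times
    [a < b]. By [cheb_wronskian], the value at [b - a] is the determinant of two nearly equal
    vectors. *)
Lemma cheb_small (R : realType) (x e : R) : -2 < x < 2 -> 0 < e ->
  exists n, (0 < n)%N /\ `|cheb x n| < e.
Proof.
move=> /andP[x1 x2] e0.
have [B B0 hB] : exists2 B : R, 0 < B & forall n, `|cheb x n| <= B.
  have d0 : 0 < 2 - `|x| by rewrite subr_gt0 ltr_norml x1.
  (* The energy identity gives [s^2 + t^2 <= 2 / (2 - |x|)]; adding 1 avoids a square root, as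
     [2 |s| <= s^2 + 1]. *)
  exists (2 / (2 - `|x|) + 1) => [|n]; first by rewrite addr_gt0 // divr_gt0.
  set q := 2 / _; have qE : q * (2 - `|x|) = 2 by rewrite divfK ?gt_eqF.
  have q0 : 0 < q by rewrite divr_gt0.
  have E := cheb_energy x n; set s := cheb x n in E *; set t := cheb x n.+1 in E.
  have : x * s * t <= `|x| * ((s ^+ 2 + t ^+ 2) / 2).
    apply: (le_trans (ler_norm _)); rewrite -mulrA normrM ler_wpM2l // ler_norml.
    by have := sqr_ge0 (s + t); have := sqr_ge0 (s - t); lra.
  move=> h; have s2 : s ^+ 2 <= q.
    have : (s ^+ 2 + t ^+ 2) * (2 - `|x|) <= q * (2 - `|x|) by rewrite qE; lra.
    by rewrite ler_pM2r //; have := sqr_ge0 t; lra.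
  by rewrite ler_norml; have := sqr_ge0 (s - 1); have := sqr_ge0 (s + 1); lra.
have d0 : 0 < e / (B + B) by rewrite divr_gt0 // addr_gt0.
have [a [b [ab h1 h2]]] := bounded_pair_recurrence d0 hB (fun n => hB n.+1).
exists (b - a)%N; split; first by rewrite subn_gt0.
rewrite -(cheb_wronskian x a) subnKC 1?ltnW //.
set s := cheb x a in h1 *; set t := cheb x a.+1 in h2 *.
rewrite (_ : _ - _ = s * (t - cheb x b.+1) - t * (s - cheb x b)); last by ring.
apply: le_lt_trans (ler_normB _ _) _; rewrite !normrM.
have <- : B * (e / (B + B)) + B * (e / (B + B)) = e.
  by rewrite -mulrDl mulrC divfK // gt_eqF // addr_gt0.
have half (u v : R) : `|u| <= B -> `|v| < e / (B + B) ->
    `|u| * `|v| < B * (e / (B + B)).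
  move=> hu hv; apply: le_lt_trans (_ : B * `|v| < _); first by rewrite ler_wpM2r.
  by rewrite ltr_pM2l.
by rewrite ltrD // half // ?hB.
Qed.

(** * Bounded solutions and the spectrum *)

Lemma normc_norm (R : realType) (z : Cplx R) : (Normc.normc z)%:C%C = `|z|.
Proof. by []. Qed.

Lemma normc_ge0 (R : realType) (z : Cplx R) : 0 <= Normc.normc z.
Proof. by case: z => a b; rewrite sqrtr_ge0. Qed.

Lemma sqsum_ge0 (R : realType) (phi : int -> Cplx R) : (0 <= sqsum phi)%E.
Proof. by apply: esum_ge0 => m _; rewrite lee_fin sqr_ge0. Qed.

Lemma sqsum_le_support (R : realType) (phi : int -> Cplx R) (s : seq int) (K : R) :
  (forall m, m \notin s -> phi m = 0) ->
  (forall m, Normc.normc (phi m) <= K) ->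
  (sqsum phi <= ((size s)%:R * K ^+ 2)%:E)%E.
Proof.
move=> s0 hK; have fs := finite_seq (undup s).
have -> : sqsum phi = \esum_(m in [set` undup s]) ((Normc.normc (phi m)) ^+ 2)%:E.
  rewrite [RHS]esum_mkcond; apply: eq_esum => m _.
  case: ifPn => //; rewrite mem_setE mem_undup => /s0 ->.
  by rewrite Normc.normc0 expr0n.
rewrite esum_fset // => [|i _]; last by rewrite lee_fin sqr_ge0.
rewrite -fsbig_seq ?undup_uniq // sumEFin lee_fin.
apply: (@le_trans _ _ (\sum_(m <- undup s) K ^+ 2)).
  apply: ler_sum => m _; rewrite lerXn2r ?nnegrE ?normc_ge0 //.
  by rewrite (le_trans _ (hK 0)) ?normc_ge0.
rewrite big_const_seq count_predT iter_addr_0 -[leLHS]mulr_natl ler_wpM2r ?sqr_ge0 //.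
by rewrite ler_nat size_undup.
Qed.

(** The infinite sum is a supremum of finite sums, and each finite index set fits into a window
    [[-N, N]]. *)
Lemma sqsum_le_trunc (R : realType) (phi : int -> Cplx R) (K : R) :
  (forall N : nat, (sqsum (fun m => if (absz m <= N)%N then phi m else 0%R) <= K%:E)%E) ->
  (sqsum phi <= K%:E)%E.
Proof.
move=> h; apply: ge_ereal_sup => _ /= [X [finX _] <-].
have [N hN] : exists N : nat, forall m, X m -> (absz m <= N)%N.
  have [s Xs] := (finite_seqP X).1 finX; exists (\max_(m <- s) absz m)%N => m.
  by rewrite Xs /= => ms; apply: leq_bigmax_seq.
apply: le_trans (h N); apply: esum_ge; exists X => //.
by apply: lee_fsum => // m Xm; rewrite hN.
Qed.

Definition bounded_eigenvalue (R : realType) (lam : Cplx R) : Prop :=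
  exists c phi : int -> Cplx R,
    [/\ (@pm1_seq R `&` @periodic_seq R) c,
        forall m, hopping c phi m = lam * phi m,
        exists m, phi m != 0
      & exists M : R, forall m, Normc.normc (phi m) <= M].

(* The truncations of a bounded solution are mapped by the operator to uniformly
   bounded vectors, so a bounded inverse would make the solution square summable,
   hence an eigenvector. *)
Lemma bounded_eigenvalue_spectrum (R : realType) (lam : Cplx R) :
  bounded_eigenvalue lam -> pi_infty R lam.
Proof.
case=> c [phi [hc heq [m0 hm0] [M hM]]]; exists c => //.
move=> [B [[_ linB [D hD]] inv]].
pose T := sub_scalar (hopping c) lam.
pose psi N := fun m : int => if (absz m <= N)%N then phi m else 0.
have T0 : T phi = fun=> 0.
  by apply/funext => m; rewrite /T /sub_scalar heq subrr.
have psiM N m : Normc.normc (psi N m) <= M.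
  by rewrite /psi; case: ifP => // _; rewrite Normc.normc0 (le_trans _ (hM 0)) ?normc_ge0.
pose K := M + M + Normc.normc lam * M.
have TpsiM N m : Normc.normc (T (psi N) m) <= K.
  rewrite /T /sub_scalar /hopping (le_trans (le_normcD _ _)) // lerD //.
    rewrite (le_trans (le_normcD _ _)) // lerD //.
    by rewrite Normc.normcM; case: (hc.1 m) => ->; rewrite ?normcN Normc.normc1 mul1r.
  by rewrite normcN Normc.normcM ler_wpM2l ?normc_ge0.
(* Only these sites see the cut: deeper inside, [T (psi N)] agrees with [T phi = 0], and further
   outside all three terms vanish. *)
pose s N : seq int := [:: N%:Z; - N%:Z; N.+1%:Z; - N.+1%:Z].
have Tpsi0 N m : m \notin s N -> T (psi N) m = 0.
  rewrite !inE !negb_or => /and4P[h1 h2 h3 h4].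
  rewrite -[RHS](congr1 (fun f => f m) T0) /T /sub_scalar /hopping /psi.
  case: (leqP (absz m) N) => hm.
    by rewrite !ifT //; lia.
  rewrite !ifF; try by lia.
  by rewrite [RHS](congr1 (fun f => f m) T0) !mulr0 subr0 addr0.
have psi0 N m :
    m \notin [seq i%:Z | i <- iota 0 N.+1] ++ [seq - i%:Z | i <- iota 0 N.+1] ->
    psi N m = 0.
  rewrite /psi mem_cat negb_or => h; rewrite ifF //; apply/negP => hm.
  move: h => /andP[].
  case: (lerP 0 m) => hm0'.
    by case/mapP; exists (absz m); [rewrite mem_iota; lia|lia].
  by move=> _ /mapP; case; exists (absz m); [rewrite mem_iota; lia|lia].
have l2psi N : l2 (psi N).
  by apply: (le_lt_trans (sqsum_le_support (psi0 N) (psiM N))); rewrite ltry.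
have sT N := sqsum_le_support (Tpsi0 N) (TpsiM N).
have l2T N : l2 (T (psi N)) by apply: (le_lt_trans (sT N)); rewrite ltry.
have l2phi : l2 phi.
  suff : (sqsum phi <= ((`|D| * Num.sqrt (4 * K ^+ 2)) ^+ 2)%:E)%E.
    by move=> h; apply: (le_lt_trans h); rewrite ltry.
  apply: sqsum_le_trunc => N; rewrite -/(psi N).
  have fin (f : int -> Cplx R) : l2 f -> sqsum f \is a fin_num.
    by move=> hf; rewrite ge0_fin_numE ?sqsum_ge0.
  have fge f : 0 <= fine (@sqsum R f) by rewrite fine_ge0 ?sqsum_ge0.
  have := hD _ (l2T N); rewrite (inv _ (l2psi N)).1 => h.
  rewrite -(fineK (fin _ (l2psi N))) lee_fin -[leLHS]sqr_sqrtr //.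
  rewrite lerXn2r ?nnegrE ?mulr_ge0 ?sqrtr_ge0 //; apply: (le_trans h).
  apply: (@le_trans _ _ (`|D| * l2norm (T (psi N)))).
    by rewrite ler_wpM2r ?sqrtr_ge0 ?ler_norm.
  rewrite ler_wpM2l // ler_sqrt; last by rewrite mulr_ge0 ?sqr_ge0.
  by rewrite -lee_fin fineK ?fin.
have l20 : l2 (fun _ : int => 0 : Cplx R).
  have := @sqsum_le_support R (fun=> 0) [::] 0 (fun _ _ => erefl).
  rewrite mul0r => h; apply: le_lt_trans (h _) (ltry _) => m; by rewrite Normc.normc0.
(* Linearity with [a = 1] gives [B 0 = B 0 + B 0]. Then [phi = B (T phi) = B 0 = 0], a
   contradiction. *)
have B0 : B (fun=> 0) = fun=> 0.
  have := linB 1 (fun=> 0) (fun=> 0) l20 l20.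
  rewrite (_ : (fun m => 1 * 0 + 0) = fun=> 0); last first.
    by apply/funext => m; rewrite mulr0 addr0.
  move=> h; apply/funext => m; have := congr1 (fun f => f m) h.
  by rewrite /= mul1r -[LHS]addr0 => /addrI <-.
move/negP: hm0; apply; apply/eqP.
by rewrite -[phi](inv _ l2phi).1 -/T T0 B0.
Qed.

(** * Pulling bounded solutions back along [P_n] *)

Lemma norm_exprz_unit (K : numFieldType) (z : K) (m : int) :
  `|z| = 1 -> `|z ^ m| = 1.
Proof.
by move=> z1; case: m => k; rewrite ?normfV normrX z1 expr1n ?invr1.
Qed.

Lemma periodic_mul (T : Type) (f : int -> T) (p : int) :
  (forall m, f (m + p) = f m) -> forall m q : int, f (m + q * p) = f m.
Proof.
move=> fp m; elim/int_ind => [|q IH|q IH]; first by rewrite mul0r addr0.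
- by rewrite -[RHS]IH -[RHS]fp intS mulrDl mul1r; congr f; ring.
- by rewrite -[RHS]IH -[LHS]fp intS; congr f; ring.
Qed.

(** Running products of [- c] solve the relation, since signs are their own inverses. They are
    periodic up to the sign [E N], which squares to 1, so twice the period of [c] works. *)
Lemma exists_sign_quotient (R : realType) (c : int -> Cplx R) :
  pm1_seq c -> periodic_seq c ->
  exists e : int -> Cplx R,
    [/\ pm1_seq e, periodic_seq e & forall j, e j * e (j - 1) = - c j].
Proof.
move=> c1 [N [N0 cN]].
have cmul := periodic_mul cN.
pose E k : Cplx R := \prod_(0 <= i < k) - c i.+1%:Z.
have ES k : E k.+1 = E k * - c k.+1%:Z by rewrite /E big_nat_recr.
have E1 k : E k = 1 \/ E k = -1.
  elim: k => [|k IH]; first by left; rewrite /E big_nil.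
  rewrite ES; case: (c1 k.+1%:Z) => ->; case: IH => ->;
    rewrite ?opprK ?mulr1 ?mulrN1 ?opprK; by [left|right].
have EN k : E (k + N)%N = E k * E N.
  elim: k => [|k IH]; first by rewrite add0n /E big_nil mul1r.
  by rewrite addSn !ES IH -addSn PoszD cN mulrAC.
pose P := (N + N)%N.
have EP : E P = 1 by rewrite /P EN; case: (E1 N) => ->; rewrite ?mulrNN mulr1.
pose e (j : int) := E (absz (j %% P)%Z).
have P0 : (P%:Z != 0) by rewrite /P; lia.
have eE (q : int) (r : nat) : (r < P)%N -> e (q * P%:Z + r%:Z) = E r.
  by move=> rP; rewrite /e modzMDl modz_small //; lia.
exists e; split.
- by move=> j; exact: E1.
- exists P; split; first by rewrite /P; lia.
  by move=> j; rewrite /e modzDr.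
move=> j; have jE := divz_eq (j - 1) P%:Z.
have [r rP rE] : exists2 r : nat, (r < P)%N & ((j - 1) %% P)%Z = r.
  have := modz_ge0 (j - 1) P0; have := ltz_mod (j - 1) P0.
  by case: (_ %% _)%Z => // r; exists r => //; lia.
set q := ((j - 1) %/ P)%Z in jE; rewrite rE in jE.
have -> : e (j - 1) = E r by rewrite jE eE.
have -> : e j = E r.+1.
  have jE' : j = q * P%:Z + r.+1%:Z by lia.
  have [rP'|rP'] := ltnP r.+1 P; first by rewrite jE' eE.
  have rE' : r.+1 = P by lia.
  rewrite rE' EP jE' rE' (_ : _ + _ = (q + 1) * P%:Z + 0%:Z); last by lia.
  by rewrite eE /E ?big_nil //; lia.
have -> : c j = c r.+1%:Z.
  by rewrite -(cmul r.+1%:Z (q * 2)); congr c; rewrite /P in jE; lia.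
by rewrite ES mulrAC; case: (E1 r) => ->; rewrite ?mulrNN !mulr1 ?mul1r.
Qed.

Lemma pm1_normc (R : realType) (c : int -> Cplx R) m :
  pm1_seq c -> Normc.normc (c m) = 1.
Proof. by case/(_ m) => ->; rewrite ?normcN Normc.normc1. Qed.

(* Sampling a solution for [lam] at the multiples of [n] gives a solution for
   [lam * cheb lam n]. Conversely, [w] below solves the equation inside a block
   with prescribed end values. The coefficients [- e j] and [e j] on the two
   sides of site [n * j] cancel the terms that would add to [lam]. *)
Lemma bounded_eigenvalue_cheb (R : realType) (n : nat) (lam : Cplx R) :
  (1 < n)%N -> lam * cheb lam n != 0 ->
  bounded_eigenvalue (lam * cheb lam n) -> bounded_eigenvalue lam.
Proof.
move=> n1; rewrite mulf_eq0 negb_or => /andP[_ sn0].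
case=> c' [phi [[c'1 c'P] heq [m0 hm0] [M hM]]].
have [e [e1 [P [P0 eP]] ee]] := exists_sign_quotient c'1 c'P.
pose s := cheb lam.
have sS k : (0 < k)%N -> s k.+1 = lam * s k - s k.-1 by case: k.
pose w (j : int) (r : nat) := (s (n - r)%N * e j * phi j + s r * phi (j + 1)) / s n.
(* At [r = 0] the block formula gives [e j * phi j], whereas the solution must take the value
   [phi j] there; the coefficient [e j] at [r = 1] absorbs the difference. *)
pose W j r := if r == 0%N then phi j else w j r.
pose G (j : int) r := if r == 1%N then e j else if r == 0%N then - e j else 1.
pose quo (m : int) := (m %/ n)%Z; pose rem (m : int) := absz (m %% n)%Z.
have n0 : n%:Z != 0 by lia.
have quoE (j : int) (r : nat) : (r < n)%N -> quo (j * n%:Z + r%:Z) = j.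
  by move=> rn; rewrite /quo divzMDl // divz_small ?addr0 //; lia.
have remE (j : int) (r : nat) : (r < n)%N -> rem (j * n%:Z + r%:Z) = r.
  by move=> rn; rewrite /rem modzMDl modz_small //; lia.
have split_int m : exists j (r : nat), (r < n)%N /\ m = j * n%:Z + r%:Z.
  exists (quo m), (rem m); have := modz_ge0 m n0; have := ltz_mod m n0.
  have := divz_eq m n; rewrite /rem -/(quo m).
  by case: (_ %% _)%Z => // r; lia.
pose c m := G (quo m) (rem m); pose u m := W (quo m) (rem m).
have cE j (r : nat) : (r < n)%N -> c (j * n%:Z + r%:Z) = G j r.
  by move=> rn; rewrite /c quoE ?remE.
have uE j (r : nat) : (r < n)%N -> u (j * n%:Z + r%:Z) = W j r.
  by move=> rn; rewrite /u quoE ?remE.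
have w0 j : w j 0 = e j * phi j.
  by rewrite /w subn0 mul0r addr0 -(mulrA (s n)) mulrAC divff // mul1r.
have wn j : w j n = phi (j + 1).
  by rewrite /w subnn !mul0r add0r mulrAC divff // mul1r.
exists c, u; split.
- split.
    move=> m; rewrite /c /G; case: ifP => _; first exact: e1.
    case: ifP => _; last by left.
    by case: (e1 (quo m)) => ->; rewrite ?opprK; [right|left].
  exists (P * n)%N; split; first by rewrite muln_gt0 P0 ltnW.
  move=> m; have [j [r [rn ->]]] := split_int m.
  rewrite (_ : _ + (P * n)%N%:Z = (j + P%:Z) * n%:Z + r%:Z); last by rewrite PoszM; ring.
  by rewrite !cE // /G eP.
- move=> m; have [j [[|r] [rn ->]]] := split_int m; rewrite /hopping cE // uE //.
    have -> : j * n%:Z + 0%:Z - 1 = (j - 1) * n%:Z + n.-1%:Z by lia.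
    have -> : j * n%:Z + 0%:Z + 1 = j * n%:Z + 1%:Z by lia.
    rewrite !uE ?prednK ?(ltnW n1) // /W /G /=.
    rewrite ifF; last by lia.
    rewrite /w subrK (_ : n - n.-1 = 1)%N; last by lia.
    rewrite -subn1 -[s 1%N]/1.
    have h := heq j; rewrite /hopping in h.
    have {}h : phi (j + 1) = lam * s n * phi j - c' j * phi (j - 1) by rewrite -h; ring.
    have cj : c' j = - (e j * e (j - 1)) by rewrite ee opprK.
    by rewrite h cj; field.
  (* Both neighbour terms of an interior site are values of [w j], even at the block ends 0 and [n],
     so the Chebyshev recurrence closes the equation. *)
  have uS : u (j * n%:Z + r.+1%:Z + 1) = w j r.+2.
    have [h|h] := ltnP r.+2 n.
      by rewrite (_ : _ + 1 = j * n%:Z + r.+2%:Z) ?uE //; lia.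
    have rE : r.+2 = n by lia.
    rewrite rE wn (_ : _ + 1 = (j + 1) * n%:Z + 0%:Z); last by lia.
    by rewrite uE //; lia.
  have uP : G j r.+1 * u (j * n%:Z + r.+1%:Z - 1) = w j r.
    rewrite (_ : _ - 1 = j * n%:Z + r%:Z); last by lia.
    rewrite uE; last by lia.
    by case: r rn {uS} => [|r] rn; rewrite /G /W /= ?w0 ?mul1r.
  rewrite uS uP /W /= /w (_ : n - r = (n - r.+2).+2)%N; last by lia.
  rewrite (_ : n - r.+1 = (n - r.+2).+1)%N; last by lia.
  rewrite /s !chebS -/s.
  by field.
- by exists (m0 * n%:Z + 0%:Z); rewrite uE //; lia.
- pose S := \sum_(i < n.+1) Normc.normc (s i).
  have sle i : (i <= n)%N -> Normc.normc (s i) <= S.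
    move=> hi; rewrite /S (bigD1 (Ordinal (hi : (i < n.+1)%N))) //= lerDl.
    by rewrite sumr_ge0 // => k _; exact: normc_ge0.
  have M0 : 0 <= M by rewrite (le_trans _ (hM 0)) ?normc_ge0.
  have S0 : 0 <= S by rewrite (le_trans _ (sle 0%N _)) ?normc_ge0.
  exists (M + (S * M + S * M) * Normc.normc (s n)^-1) => m.
  have [j [r [rn ->]]] := split_int m; rewrite uE // /W; case: eqP => _.
    by rewrite (le_trans (hM _)) // lerDl mulr_ge0 ?normc_ge0 // addr_ge0 ?mulr_ge0.
  rewrite (@le_trans _ _ ((S * M + S * M) * Normc.normc (s n)^-1)) ?lerDr //.
  rewrite /w Normc.normcM ler_wpM2r ?normc_ge0 // (le_trans (le_normcD _ _)) // lerD //.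
    by rewrite !Normc.normcM pm1_normc // mulr1 ler_pM ?normc_ge0 ?sle ?leq_subr.
  by rewrite Normc.normcM ler_pM ?normc_ge0 ?sle // ltnW.
Qed.

(** * Bounded eigenvalues dense in the unit disc *)

(** For [c = 1] the wave [z ^ m] with [|z| = 1] has eigenvalue [z + 1/z], twice the real part of
    [z]. *)
Lemma bounded_eigenvalue_itv (R : realType) (x : R) :
  -2 <= x <= 2 -> bounded_eigenvalue (x%:C%C : Cplx R).
Proof.
move=> /andP[x1 x2]; pose y := Num.sqrt (1 - (x / 2) ^+ 2).
have y2 : y ^+ 2 = 1 - (x / 2) ^+ 2.
  by rewrite sqr_sqrtr // subr_ge0 expr2; nra.
pose z : Cplx R := (x / 2 +i* y)%C.
have nz : `|z| = 1 by rewrite normc_def /= y2 addrC subrK sqrtr1.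
have z0 : z != 0 by rewrite -normr_eq0 nz oner_eq0.
have zz : z * z + 1 = x%:C%C * z.
  apply/eqP; rewrite eq_complex /= -expr2; apply/andP; split; apply/eqP.
    by rewrite -[y * y]expr2 y2; field.
  by field.
exists (fun=> 1), (fun m => z ^ m); split.
- by split; [move=> m; left|exists 1%N].
- move=> m; rewrite /hopping mul1r !expfzDr // expr1z.
  rewrite -mulrDr mulrC; congr (_ * _); apply: (mulfI z0).
  by rewrite mulrDr divff // addrC zz mulrC.
- by exists 0; rewrite expr0z oner_eq0.
- exists 1 => m; rewrite -lecR normc_norm.
  by rewrite norm_exprz_unit.
Qed.

Lemma bounded_eigenvalue_dyadic_root (R : realType) (k : nat) (x : R) (w : Cplx R) :
  w != 0 -> -2 <= x <= 2 -> w ^+ (2 ^ k) = x%:C%C -> bounded_eigenvalue w.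
Proof.
move=> + x2; elim: k w => [|k IH] w w0 wk.
  by rewrite -[w]expr1 wk; exact: bounded_eigenvalue_itv.
have ww : w * cheb w 2 = w ^+ 2 by rewrite /= mulr1 subr0.
apply: (@bounded_eigenvalue_cheb _ 2) => //; rewrite ww ?expf_neq0 //.
by apply: IH; rewrite ?expf_neq0 // -exprM -expnS.
Qed.

(** Multiplying the solution by [i^m] turns [c] into [- c], because [- i^(-1) = i]. *)
Lemma bounded_eigenvalue_rotate (R : realType) (lam : Cplx R) :
  bounded_eigenvalue lam -> bounded_eigenvalue (('i%C : Cplx R) * lam).
Proof.
case=> c [phi [[c1 [N [N0 cN]]] heq [m0 hm0] [M hM]]].
have ni : `|('i%C : Cplx R)| = 1.
  by rewrite normc_def /= expr0n add0r expr1n sqrtr1.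
have i0 : ('i%C : Cplx R) != 0 by rewrite -normr_eq0 ni oner_eq0.
have ii : ('i%C : Cplx R) * 'i%C = -1 by rewrite -expr2 sqr_i.
exists (fun m => - c m), (fun m => 'i%C ^ m * phi m); split.
- split; last by exists N; split=> // m; rewrite cN.
  by move=> m; case: (c1 m) => ->; rewrite ?opprK; [right|left].
- move=> m; rewrite mulrACA -heq /hopping !expfzDr // expr1z.
  rewrite -[_ ^ (-1)]/('i%C^-1).
  have -> : ('i%C : Cplx R)^-1 = - 'i%C.
    by apply: (mulfI i0); rewrite divff // mulrN ii opprK.
  ring.
- by exists m0; rewrite mulf_neq0 // expfz_neq0.
- exists M => m; rewrite Normc.normcM.
  suff -> : Normc.normc (('i%C : Cplx R) ^ m) = 1 by rewrite mul1r.
  by apply: complexI; rewrite normc_norm norm_exprz_unit.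
Qed.

Lemma bounded_eigenvalue_dense (R : realType) (v d : Cplx R) :
  `|v| < 1 -> 0 < d -> exists w, [/\ w != 0, bounded_eigenvalue w & `|v - w| < d].
Proof.
move=> v1 d0; have [e dE e0] : exists2 e : R, d = e%:C%C & 0 < e.
  case: d d0 => a b; rewrite ltcE /= => /andP[/eqP -> a0].
  by exists a.
have [->|v0] := eqVneq v 0.
  (* A small positive number approximates 0, since [w] itself has to be nonzero. *)
  exists (Num.min (e / 2) 1)%:C%C.
  have m0 : 0 < Num.min (e / 2) 1 by rewrite lt_min ltr01 divr_gt0.
  split.
  - by rewrite (inj_eq (@complexI _)) gt_eqF.
  - apply: bounded_eigenvalue_itv; rewrite ge_min; apply/andP; split.
      by apply: ltW; apply: lt_trans m0; lra.
    by apply/orP; right; lra.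
  - rewrite sub0r normrN -normc_norm /= expr0n addr0 sqrtr_sqr gtr0_norm // dE ltcR.
    by rewrite gt_min; apply/orP; left; lra.
pose a := Normc.normc v.
have aE : `|v| = a%:C%C by [].
have a1 : 0 <= a <= 1 by rewrite normc_ge0 -lecR -aE ltW.
(* With this [k], the bound [2^k |v - w|^2 <= 4 |v|^2 <= 4] of [dyadic_root_close] forces
   [|v - w| < e]. *)
have [k hk] : exists k : nat, 4 < 2 ^+ k * e ^+ 2.
  exists (Num.truncn (4 / e ^+ 2)).+1; set t := Num.truncn _.
  rewrite -ltr_pdivrMr ?exprn_gt0 //; apply: (@lt_trans _ _ t.+1%:R).
    by rewrite truncnS_gt.
  by rewrite -natrX ltr_nat ltn_expl.
have [w [wn wk wd]] := dyadic_root_close k v.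
have w0 : w != 0 by rewrite -normr_eq0 wn normr_eq0.
exists w; split=> //.
  apply: (@bounded_eigenvalue_dyadic_root _ k (a ^+ (2 ^ k))) => //.
    case/andP: a1 => a0 a1; have := exprn_ge0 (2 ^ k) a0.
    have := exprn_ile1 (2 ^ k) a0 a1; move: (a ^+ _) => t; clear; lra.
  by rewrite wk aE rmorphXn.
move: wd; rewrite aE -normc_norm dE ltcR.
have -> : (2 : Cplx R) = 2%:C%C by rewrite rmorph_nat.
have -> : (4 : Cplx R) = 4%:C%C by rewrite rmorph_nat.
rewrite -!(rmorphXn (real_complex R)) -!(rmorphM (real_complex R)) lecR => wd.
rewrite ltNge; apply/negP => ed.
have ke : 2 ^+ k * e ^+ 2 <= 2 ^+ k * Normc.normc (v - w) ^+ 2.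
  by rewrite ler_wpM2l ?exprn_ge0 // lerXn2r ?nnegrE ?normc_ge0 ?(ltW e0).
have a2 : a ^+ 2 <= 1 by case/andP: a1 => a0 a1; rewrite exprn_ile1.
have := lt_le_trans (lt_le_trans hk ke) wd.
by rewrite -ltr_pdivrMl // mulVf // ltNge a2.
Qed.

(** * Open sets inside the closure *)

Lemma continuous_cheb (K : numFieldType) n : continuous (fun x : K => cheb x n).
Proof.
suff [] : continuous (fun x : K => cheb x n) /\
  continuous (fun x : K => cheb x n.+1) by [].
elim: n => [|n [IH1 IH2]].
  by split; [exact: (@cst_continuous _ _ (0 : K))|exact: (@cst_continuous _ _ (1 : K))].
split=> // x.
rewrite (_ : (fun y : K => cheb y n.+2) = fun y => y * cheb y n.+1 - cheb y n) //.
exact: (continuousB (continuousM (@cvg_id _ _) (IH2 x)) (IH1 x)).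
Qed.

(** A bounded eigenvalue [w] lies close to [P_n(u * lam)]; then [P_n - w] is small at [u * lam] and
    has a root nearby, again a bounded eigenvalue. The factor [u] carries the gauge rotation. *)
Lemma Sigma_pi_cheb (R : realType) (u lam : Cplx R) (n : nat) :
  `|u| = 1 -> (forall z, bounded_eigenvalue (u * z) -> bounded_eigenvalue z) ->
  (1 < n)%N -> `|u * lam * cheb (u * lam) n| < 1 -> Sigma_pi R lam.
Proof.
move=> u1 hu n1 lt1 B /nbhs_ballP[e e0 eB].
have u0 : u != 0 by rewrite -normr_eq0 u1 oner_eq0.
(* The tolerance [e ^+ n] matches the degree [n] of [P_n - w] in [root_close]. *)
have [w [w0 hw wd]] := bounded_eigenvalue_dense lt1 (exprn_gt0 n e0).
pose p : {poly Cplx R} := 'X * cheb 'X n - w%:P.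
have sq : size ('X * cheb ('X : {poly Cplx R}) n) = n.+1.
  by rewrite mulrC size_mulX ?size_cheb // -size_poly_eq0 size_cheb; lia.
have sw : (size (- w%:P) < n.+1)%N.
  by rewrite size_polyN (leq_ltn_trans (size_polyC_leq1 _)); lia.
have sp : size p = n.+1 by rewrite size_polyDl sq.
have pm : p \is monic.
  rewrite monicE lead_coefDl ?sq // mulrC lead_coefMX -monicE.
  by rewrite -(prednK (ltnW n1)) monic_cheb.
have [] := @root_close _ p (u * lam) e pm e0.
  by rewrite sp hornerD hornerN hornerC hornerM hornerX horner_cheb.
move=> y; rewrite /root hornerD hornerN hornerC hornerM hornerX horner_cheb.
rewrite subr_eq0 => /eqP yw yd.
exists (u^-1 * y); split.
  apply/bounded_eigenvalue_spectrum/hu; rewrite mulrA divff // mul1r.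
  by apply: (bounded_eigenvalue_cheb n1); rewrite yw.
apply: eB; rewrite -ball_normE /= -[lam](mulKf u0) -mulrBr normrM normfV u1 invr1.
by rewrite mul1r.
Qed.

Lemma Sigma_pi_interior (R : realType) (u lam : Cplx R) (x : R) :
  `|u| = 1 -> (forall z, bounded_eigenvalue (u * z) -> bounded_eigenvalue z) ->
  u * lam = x%:C%C -> -2 < x < 2 -> interior (Sigma_pi R) lam.
Proof.
(* As [|x| < 2], the bound 1/2 yields [|P_n(x)| < 1]; it also excludes [n = 1], where
   [cheb x 1 = 1]. *)
move=> u1 hu ulam x2; have [|n [n0 hn]] := @cheb_small R x (1 / 2) x2; first by lra.
have n1 : (1 < n)%N by case: n n0 hn => [|[|n]] // _; rewrite /= normr1; lra.
have cont : {for lam, continuous (fun z => u * z * cheb (u * z) n)}.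
  have cu : {for lam, continuous (fun z => u * z)}
    by exact: (continuousM (cvg_cst u) (@cvg_id _ _)).
  exact: (continuousM cu (continuous_comp cu (@continuous_cheb _ n (u * lam)))).
have q1 : `|u * lam * cheb (u * lam) n| < 1.
  rewrite ulam -rmorph_cheb -rmorphM normc_def /= expr0n addr0 sqrtr_sqr ltcR normrM.
  have : `|x| < 2 by rewrite ltr_norml.
  by have := normr_ge0 x; have := normr_ge0 (cheb x n); nra.
have near_lt : nbhs lam [set z | `|u * z * cheb (u * z) n| < 1].
  exact: cvgr_norm_lt cont _ q1.
have sub : [set z | `|u * z * cheb (u * z) n| < 1] `<=` Sigma_pi R.
  by move=> z; exact: Sigma_pi_cheb.
exact: filterS sub near_lt.
Qed.

Theorem corollary4p4 (R : realType) :
  real_segment R `|` imag_segment R `<=` interior (Sigma_pi R).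
Proof.
move=> _ [[x xI <-]|[x xI <-]].
  by apply: (@Sigma_pi_interior _ 1 _ x); rewrite ?normr1 ?mul1r // => z; rewrite mul1r.
have ii : ('i%C : Cplx R) * 'i%C = -1 by rewrite -expr2 sqr_i.
(* The factor [- i] takes [i x] back to [x], and rotation by [i] undoes it. *)
apply: (@Sigma_pi_interior _ (- 'i%C) _ x) => //.
- by rewrite normrN normc_def /= expr0n add0r expr1n sqrtr1.
- move=> z /bounded_eigenvalue_rotate.
  by rewrite mulrA mulrN ii opprK mul1r.
- by rewrite mulrA mulNr ii opprK mul1r.
Qed.
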